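(* Let $w_n$ be the number of weak-ordering chains in $\mathcal{WOC}(n)$ subject to the stopping condition $x_i=x_j$ with $i\neq j$ (i.e. a chain contains the stopping condition if two distinct variables are equal in it). Then $w_n = 2\,n!-1$ for all $n\ge 1$. The sequence starts $1,3,11,47,239,1439,10079,80639,\dots$.
   Context: A weak-ordering chain on $x_1,\dots,x_m$ is an expression $x_{i_1}\,\mathrm{op}\,x_{i_2}\,\mathrm{op}\cdots\mathrm{op}\,x_{i_m}$, where $(i_1,\dots,i_m)$ is an ordering of $[m]=\{1,\dots,m\}$ and each $\mathrm{op}$ is $<$ or $=$; two expressions defining the same ordered set partition of $[m]$ (blocks = index sets of equal variables, ordered by increasing value) are identified. $\mathcal{WOC}(m)$ is the set of these chains. Each chain in $\mathcal{WOC}(m)$, $m\ge 2$, arises uniquely from its restriction to $x_1,\dots,x_{m-1}$ (a chain in $\mathcal{WOC}(m-1)$) by inserting $x_m$ (either as equal to an existing class or as a new class in some position); this gives a rooted tree with root $x_1$ whose level-$m$ nodes are the elements of $\mathcal{WOC}(m)$. Given a stopping condition, the restricted generating tree of order $n$ is the part of this tree up to level $n$ in which any node whose chain contains the stopping condition has no descendants. Its leaves are the nodes at level $n$ together with the nodes containing the stopping condition. ''The number of weak-ordering chains in $\mathcal{WOC}(n)$ subject to the stopping condition'' means the number of leaves of this restricted tree of order $n$; equivalently, the number of chains in $\mathcal{WOC}(n)$ not containing the condition plus, for each $1\le j\le n$, the number of chains in $\mathcal{WOC}(j)$ that contain the condition while their restriction to $x_1,\dots,x_{j-1}$ does not. 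*)

(* Defs.v *)
From HB Require Import structures.
From mathcomp Require Import all_boot.

Set Implicit Arguments.
Unset Strict Implicit.
Unset Printing Implicit Defensive.

(* Throughout, i : 'I_m is the index of the variable x_(i+1).                 *)

Definition ordered_set_partition m (s : seq {set 'I_m}) : bool :=
  uniq s && partition [set B in s] [set: 'I_m].

(* A weak-ordering chain on x_1, ..., x_m: the ordered set partition whose    *)
(* blocks are the classes of equal variables, listed by increasing value.     *)
Record woc (m : nat) : Type := Woc {
  blocks : seq {set 'I_m};
  blocksP : ordered_set_partition blocks
}.

HB.instance Definition _ m := [isSub for @blocks m].
HB.instance Definition _ m := [Countable of woc m by <:].

Definition woc_enum m : seq (woc m) :=
  undup (pmap insub [seq s | P : {set {set 'I_m}} <- enum setT,
                             s : seq {set 'I_m} <- permutations (enum P)]).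

Lemma woc_enumP m : Finite.axiom (woc_enum m).
Proof.
move=> c; rewrite count_uniq_mem ?undup_uniq // mem_undup mem_pmap_sub /=.
apply/eqP; rewrite eqb1; apply/allpairsPdep.
exists [set B in blocks c], (blocks c).
rewrite mem_enum inE mem_permutations; split=> //.
case/andP: (blocksP c) => Uc _; apply: uniq_perm => //; first exact: enum_uniq.
by move=> B; rewrite mem_enum inE.
Qed.

HB.instance Definition _ m := isFinite.Build (woc m) (@woc_enumP m).

Definition restrict_blocks m (s : seq {set 'I_m.+1}) : seq {set 'I_m} :=
  [seq B <- [seq widen_ord (leqnSn m) @^-1: C | C : {set 'I_m.+1} <- s]
     | B != set0].

Lemma restrict_blocksP m (s : seq {set 'I_m.+1}) :
  ordered_set_partition s -> ordered_set_partition (restrict_blocks s).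
Proof.
case/andP=> Us /and3P[/eqP covs /trivIsetP tis _].
have disj C D i : C \in s -> D \in s -> i \in C -> i \in D -> C = D.
  move=> sC sD Ci Di; apply: contraTeq Di => neCD.
  have := tis C D; rewrite !inE => /(_ sC sD neCD) /disjoint_setI0/setP/(_ i).
  by rewrite !inE Ci /= => ->.
apply/andP; split.
  rewrite /restrict_blocks filter_map map_inj_in_uniq ?filter_uniq //.
  move=> C D; rewrite !mem_filter => /andP[/set0Pn[i Ci] sC] /andP[_ sD] eqCD.
  have Di := Ci; rewrite /= eqCD in Di; rewrite !inE in Ci Di.
  exact: disj sC sD Ci Di.
apply/and3P; split.
- apply/eqP/setP=> i; rewrite inE; apply/bigcupP.
  have : widen_ord (leqnSn m) i \in cover [set B in s] by rewrite covs inE.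
  case/bigcupP=> C; rewrite inE => sC Ci.
  have Ci' : i \in widen_ord (leqnSn m) @^-1: C by rewrite inE.
  exists (widen_ord (leqnSn m) @^-1: C) => //; rewrite inE mem_filter.
  by apply/andP; split; [apply/set0Pn; exists i | apply: map_f].
- apply/trivIsetP=> A B; rewrite !inE !mem_filter.
  case/andP=> _ /mapP[C sC ->] /andP[_ /mapP[D sD ->]].
  apply: contraR => /pred0Pn[i /andP[/=]]; rewrite !inE => Ci Di.
  by rewrite (disj _ _ _ sC sD Ci Di).
- by rewrite inE mem_filter eqxx.
Qed.

(* The chain on x_1, ..., x_m obtained from one on x_1, ..., x_(m+1) by       *)
(* deleting x_(m+1); this is the parent in the generating tree.               *)
Definition restrict m (c : woc m.+1) : woc m :=
  Woc (restrict_blocksP (blocksP c)).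

(* A node lies in the restricted tree when no proper ancestor (of level at    *)
(* least 1) contains the stopping condition. The root is the unique chain on  *)
(* x_1, so the empty chain of level 0 is not a node.                          *)
Fixpoint is_node (stop : forall m, pred (woc m)) m : pred (woc m) :=
  match m with
  | 0 => fun=> false
  | k.+1 => fun c =>
      (k == 0) || is_node stop (restrict c) && ~~ stop k (restrict c)
  end.

Definition leaves (stop : forall m, pred (woc m)) (n m : nat) : {set woc m} :=
  [set c | is_node stop c & (m == n) || stop m c].

Definition num_leaves (stop : forall m, pred (woc m)) (n : nat) : nat :=
  \sum_(1 <= m < n.+1) #|leaves stop n m|.

Definition equal_in m (c : woc m) (i j : 'I_m) : bool :=
  has (fun B : {set 'I_m} => (i \in B) && (j \in B)) (blocks c).

Definition has_equality m : pred (woc m) :=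
  fun c => [exists i, exists j, (i != j) && equal_in c i j].

(* Main.v *)
Require Import Defs.
From mathcomp Require Import all_boot.

Set Implicit Arguments.
Unset Strict Implicit.
Unset Printing Implicit Defensive.

(* A node of level m.+1 of the restricted tree is a chain whose restriction   *)
(* is strict: either it is itself strict, or x_(m+1) equals exactly one of    *)
(* the strictly ordered x_1, ..., x_m. In both cases its classes are the      *)
(* fibres of a given surjection, in an arbitrary order, which gives m.+1`!    *)
(* chains of the first kind and m * m`! of the second. The sum over the       *)
(* levels telescopes since m * m`! = m.+1`! - m`!.                            *)

(** Both counts come from [card_chains_with_kernel]: fixing which variables are equal, by a
    surjection [f] onto [T], leaves only the order of the #|T| classes free. The identity gives
    [card_strict_chains]; the maps [merge_last i] give [card_first_equality]. Equalities persist
    when variables are added, so [card_leaves] need only consider chains whose parent is strict. *)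

Lemma equal_in_pblock m (c : woc m) x y :
  equal_in c x y
    = (pblock [set B in blocks c] x == pblock [set B in blocks c] y).
Proof.
have /andP[_ /and3P[/eqP covc tic _]] := blocksP c.
have cov z : z \in cover [set B in blocks c] by rewrite covc inE.
rewrite eq_pblock //; apply/hasP/idP => [[B cB /andP[Bx By]]|xy].
  by rewrite (def_pblock tic _ Bx) // inE.
exists (pblock [set B in blocks c] x); last by rewrite mem_pblock cov.
by have := pblock_mem (cov x); rewrite inE.
Qed.

Lemma mem_block m (c : woc m) B x y :
  B \in blocks c -> x \in B -> (y \in B) = equal_in c x y.
Proof.
have /andP[_ /and3P[/eqP covc tic _]] := blocksP c.
move=> cB Bx; rewrite equal_in_pblock eq_pblock ?covc //.
by rewrite (def_pblock tic _ Bx) // inE.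
Qed.

Lemma equal_in_restrict m (c : woc m.+1) i j :
  equal_in (restrict c) i j = equal_in c (lift ord_max i) (lift ord_max j).
Proof.
have widenE k : widen_ord (leqnSn m) k = lift ord_max k.
  by apply: val_inj; rewrite /= /bump leqNgt ltn_ord.
apply/hasP/hasP => [[B]|[C cC /andP[Ci Cj]]].
  rewrite mem_filter => /andP[_ /mapP[C cC ->]].
  by rewrite !inE !widenE; exists C.
exists (widen_ord (leqnSn m) @^-1: C); last by rewrite !inE !widenE Ci.
rewrite mem_filter map_f // andbT.
by apply/set0Pn; exists i; rewrite inE widenE.
Qed.

Lemma has_equalityPn m (c : woc m) :
  reflect (forall i j, equal_in c i j = (i == j)) (~~ has_equality c).
Proof.
apply: (iffP existsPn) => [neq i j|eqc i]; last first.
  by apply/existsPn=> j; rewrite eqc andNb.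
case: eqP => [->|/eqP neq_ij]; first by rewrite equal_in_pblock eqxx.
by have /existsPn/(_ j) := neq i; rewrite neq_ij => /negbTE.
Qed.

Lemma has_equality_restrict m (c : woc m.+1) :
  has_equality (restrict c) -> has_equality c.
Proof.
apply: contraTT => /has_equalityPn eqc; apply/has_equalityPn=> i j.
by rewrite equal_in_restrict eqc (inj_eq lift_inj).
Qed.

(** An equality in any ancestor survives in the parent, so testing the parent suffices. For the
    root, the restriction is the empty chain, which is vacuously strict. *)
Lemma is_node_has_equality m (c : woc m.+1) :
  is_node has_equality c = ~~ has_equality (restrict c).
Proof.
elim: m c => [|m IHm] c /=; first by apply/esym/has_equalityPn; case.
rewrite -/(is_node has_equality (restrict c)) IHm andb_idl //.
by apply: contra => /has_equality_restrict.
Qed.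

Definition chains_with_kernel m (T : finType) (f : 'I_m -> T) : {set woc m} :=
  [set c | [forall x, forall y, equal_in c x y == (f x == f y)]].

Lemma chains_with_kernelP m (T : finType) (f : 'I_m -> T) (c : woc m) :
  reflect (forall x y, equal_in c x y = (f x == f y))
          (c \in chains_with_kernel f).
Proof.
rewrite inE; apply: (iffP forallP) => [eqc x y|eqc x].
  by apply/eqP; move: y; apply/forallP.
by apply/forallP=> y; rewrite eqc.
Qed.

Section Fibres.

Variables (m : nat) (T : finType) (f : 'I_m -> T).
Hypothesis f_surj : forall t, exists x, f x = t.

Let fibres := [seq f @^-1: [set t] | t <- enum T].

Lemma uniq_fibres : uniq fibres.
Proof.
rewrite map_inj_uniq ?enum_uniq // => t u eqf.
have [x fx] := f_surj t; have /setP/(_ x) := eqf.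
by rewrite !inE fx eqxx => /esym/eqP.
Qed.

Lemma fibres_partition : ordered_set_partition fibres.
Proof.
rewrite /ordered_set_partition uniq_fibres /=; apply/and3P; split.
- apply/eqP/setP=> x; rewrite inE; apply/bigcupP.
  exists (f @^-1: [set f x]); last by rewrite !inE.
  by rewrite inE map_f ?mem_enum.
- apply/trivIsetP=> A B; rewrite !inE => /mapP[t _ ->] /mapP[u _ ->].
  apply: contraR => /pred0Pn[x /andP[/=]].
  by rewrite !inE => /eqP-> /eqP->.
- rewrite inE; apply/mapP=> -[t _ /setP eq0].
  by have [x fx] := f_surj t; have := eq0 x; rewrite !inE fx eqxx.
Qed.

(** A block is the fibre through any of its points. Conversely, surjectivity gives each fibre a
    point, and the block of that point is the fibre. *)
Lemma perm_blocks_fibres c :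
  (c \in chains_with_kernel f) = perm_eq (blocks c) fibres.
Proof.
have /andP[Uc /and3P[/eqP covc _ nz]] := blocksP c.
apply/chains_with_kernelP/idP => [eqc | /perm_mem eqbl x y].
  have blockE B x : B \in blocks c -> x \in B -> B = f @^-1: [set f x].
    by move=> cB Bx; apply/setP=> y; rewrite !inE (mem_block _ cB Bx) eqc eq_sym.
  apply: uniq_perm uniq_fibres _ => // B; apply/idP/mapP => [cB|[t _ ->]].
    have /set0Pn[x Bx]: B != set0.
      by apply: contraNneq nz => <-; rewrite inE.
    by exists (f x); rewrite ?mem_enum //; apply: blockE.
  have [x <-] := f_surj t.
  have /bigcupP[C]: x \in cover [set B in blocks c] by rewrite covc inE.
  by rewrite inE => cC Cx; rewrite -(blockE C x).
rewrite /equal_in (eq_has_r eqbl); apply/hasP/eqP => [[B /mapP[t _ ->]]|fxy].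
  by rewrite !inE => /andP[/eqP-> /eqP->].
exists (f @^-1: [set f x]); first by rewrite map_f ?mem_enum.
by rewrite !inE fxy eqxx.
Qed.

Lemma card_chains_with_kernel : #|chains_with_kernel f| = #|T|`!.
Proof.
have perm_part s : s \in permutations fibres -> ordered_set_partition s.
  rewrite mem_permutations => eqs; have := fibres_partition.
  rewrite /ordered_set_partition (perm_uniq eqs); congr (_ && partition _ _).
  by apply/setP=> B; rewrite !inE (perm_mem eqs).
pose cs : seq (woc m) := pmap insub (permutations fibres).
have Ucs : uniq cs by apply/pmap_sub_uniq/permutations_uniq.
rewrite (eq_card (B := mem cs)) => [|c]; last first.
  by rewrite mem_pmap_sub mem_permutations perm_blocks_fibres.
(* By [perm_part], [insub] discards no permutation. *)
rewrite (card_uniqP Ucs) size_pmap_sub (eq_in_count (a2 := predT)) //.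
by rewrite count_predT size_permutations ?uniq_fibres // size_map -cardE.
Qed.

End Fibres.

Lemma strict_chainsE m :
  [set c : woc m | ~~ has_equality c] = chains_with_kernel id.
Proof.
apply/setP=> c; rewrite inE.
by apply/has_equalityPn/chains_with_kernelP.
Qed.

Lemma card_strict_chains m : #|[set c : woc m | ~~ has_equality c]| = m`!.
Proof.
by rewrite strict_chainsE card_chains_with_kernel ?card_ord // => t; exists t.
Qed.

(** The default [i] is the value at [ord_max]; every other index is sent to itself. *)
Definition merge_last m (i : 'I_m) (x : 'I_m.+1) : 'I_m :=
  odflt i (unlift ord_max x).

Lemma merge_last_lift m (i j : 'I_m) : merge_last i (lift ord_max j) = j.
Proof. by rewrite /merge_last liftK. Qed.

Lemma merge_last_max m (i : 'I_m) : merge_last i ord_max = i.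
Proof. by rewrite /merge_last unlift_none. Qed.

Definition first_equality m : {set woc m.+1} :=
  [set c | ~~ has_equality (restrict c) & has_equality c].

(** With a strict restriction, an equality must involve the last variable; by transitivity its
    partner [i] is unique and determines the whole kernel. *)
Lemma first_equalityE m :
  first_equality m = \bigcup_i chains_with_kernel (@merge_last m i).
Proof.
apply/setP=> c; rewrite inE; apply/andP/bigcupP => [[/has_equalityPn eqr]|].
  have eqc i j : equal_in c (lift ord_max i) (lift ord_max j) = (i == j).
    by rewrite -equal_in_restrict eqr.
  have sym x y : equal_in c x y = equal_in c y x.
    by rewrite !equal_in_pblock eq_sym.
  have merge i : equal_in c (lift ord_max i) ord_max ->
      exists2 i, i \in 'I_m & c \in chains_with_kernel (@merge_last m i).
    move=> eqi; exists i => //.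
    have eq_max j : equal_in c (lift ord_max j) ord_max = (j == i).
      rewrite -eqc !equal_in_pblock; rewrite equal_in_pblock in eqi.
      by rewrite (eqP eqi).
    apply/chains_with_kernelP=> x y.
    case: (unliftP ord_max x) => [j|] ->; case: (unliftP ord_max y) => [k|] ->;
      rewrite ?merge_last_lift ?merge_last_max //.
    - by rewrite sym eq_max eq_sym.
    - by rewrite equal_in_pblock !eqxx.
  case/existsP=> x /existsP[y /andP[]].
  case: (unliftP ord_max x) => [j|] ->; case: (unliftP ord_max y) => [k|] ->.
  - by rewrite eqc (inj_eq lift_inj) => /negPf->.
  - by move=> _; apply: merge.
  - by rewrite sym => _; apply: merge.
  - by rewrite eqxx.
case=> i _ /chains_with_kernelP eqc; split.
  by apply/has_equalityPn=> j k; rewrite equal_in_restrict eqc !merge_last_lift.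
apply/existsP; exists ord_max; apply/existsP; exists (lift ord_max i).
by rewrite neq_lift eqc merge_last_max merge_last_lift eqxx.
Qed.

Lemma card_first_equality m : #|first_equality m| = m * m`!.
Proof.
rewrite first_equalityE -sum1_card partition_disjoint_bigcup => [|i j neq_ij].
  under eq_bigr => i _.
    rewrite sum1_card card_chains_with_kernel; last first.
      by move=> t; exists (lift ord_max t); rewrite merge_last_lift.
    rewrite card_ord; over.
  by rewrite sum_nat_const card_ord.
(* The union is disjoint: a chain common to [i] and [j] equates the last variable with [j], and
   kernel [merge_last i] then forces [i = j]. *)
apply: contraR neq_ij => /pred0Pn[c /andP[/=]].
move=> /chains_with_kernelP/(_ ord_max (lift ord_max j)) ci.
move=> /chains_with_kernelP/(_ ord_max (lift ord_max j)) cj.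
by move: ci; rewrite cj !merge_last_max !merge_last_lift eqxx => <-.
Qed.

Lemma card_leaves n m :
  #|leaves has_equality n m.+1| = m * m`! + (m.+1 == n) * m.+1`!.
Proof.
rewrite -card_first_equality.
(* Leaves with an equality occur at every level and are the first equalities; strict leaves occur
   only at level [n], where every strict chain is one. *)
rewrite -(cardsID [set c | has_equality c]); congr (_ + _).
  apply: eq_card => c; rewrite !inE is_node_has_equality.
  by case: (has_equality c); rewrite ?orbT ?andbT ?andbF.
case E: (m.+1 == n); rewrite ?mul1n ?mul0n -?card_strict_chains.
  apply: eq_card => c; rewrite !inE is_node_has_equality E andbT.
  by rewrite andb_idr //; apply: contra => /has_equality_restrict.
apply/eqP; rewrite cards_eq0; apply/eqP/setP=> c; rewrite !inE.
by rewrite E; case: (has_equality c); rewrite ?andbF.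
Qed.

Lemma sum_mul_fact n : \sum_(0 <= i < n) i * i`! = n`! - 1.
Proof.
elim: n => [|n IHn]; first by rewrite big_nil.
by rewrite big_nat_recr //= IHn addnBAC ?fact_gt0 // factS mulSn.
Qed.

Lemma num_leaves_has_equality n :
  0 < n -> num_leaves has_equality n = 2 * n`! - 1.
Proof.
case: n => // n _; rewrite /num_leaves big_add1 /=.
under eq_bigr do rewrite card_leaves.
rewrite big_split /= sum_mul_fact big_nat_recr //= eqxx mul1n.
(* Below the last level the indicator of strict leaves vanishes. *)
rewrite big_nat_cond big1 => [|i /andP[/andP[_ lt_in] _]]; last first.
  by rewrite eqSS (ltn_eqF lt_in).
by rewrite add0n addnBAC ?fact_gt0 // mul2n addnn.
Qed.

Theorem theorem1 :
  (forall n : nat, 1 <= n -> num_leaves has_equality n = 2 * n`! - 1) /\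
  [seq num_leaves has_equality n | n <- iota 1 8]
    = [:: 1; 3; 11; 47; 239; 1439; 10079; 80639].
Proof.
split; first exact: num_leaves_has_equality.
have numE : {in iota 1 8, num_leaves has_equality =1 fun n => 2 * n`! - 1}.
  move=> n; rewrite mem_iota => /andP[n_gt0 _].
  exact: num_leaves_has_equality.
(* Only the closed formula is evaluated here; no chains are enumerated. *)
by move/eq_in_map: numE => ->; apply/eqP; vm_compute.
Qed.
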